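(* Let $n\ge1$, $d=2^n$, and let $U$ be a fixed $d\times d$ unitary. The cost functions $C_{LET}$ and $C_{LLET}$ of fixed input state compiling exhibit weak Optimal Parameter Resilience (weak-OPR) to Noise Model 3. That is, for every choice of the noise channels, noise parameters and factorizations allowed in Noise Model 3 (spelled out in the context), if $\widetilde C_{LET}$ and $\widetilde C_{LLET}$ denote the corresponding noisy cost functions on the set $\mathbb V_d$ of all $d\times d$ unitary matrices, then $$\{V'\in\mathbb V_d:\widetilde C_{LET}(V')=\min_{V\in\mathbb V_d}\widetilde C_{LET}(V)\}\subseteq\{V'\in\mathbb V_d: C_{LET}(V')=\min_{V\in\mathbb V_d}C_{LET}(V)\}$$ and $$\{V'\in\mathbb V_d:\widetilde C_{LLET}(V')=\min_{V\in\mathbb V_d}\widetilde C_{LLET}(V)\}\subseteq\{V'\in\mathbb V_d: C_{LLET}(V')=\min_{V\in\mathbb V_d}C_{LLET}(V)\}.$$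
   Context: **Systems and costs.** $A=A_1\cdots A_n$ is an $n$-qubit system; $\mathbb V_d$ is the set of $d\times d$ unitaries, $d=2^n$; $U$ is the fixed target, $V\in\mathbb V_d$ the trainable unitary, $W=V^\dagger U$. A calligraphic letter denotes conjugation by the unitary, e.g. $\mathcal W(\rho)=W\rho W^\dagger$. The Loschmidt Echo Test (LET) circuit prepares $|\mathbf 0\rangle=|0\rangle^{\otimes n}$, applies $W$, and measures all qubits in the standard basis: $C_{LET}(V)=1-|\langle\mathbf 0|W|\mathbf 0\rangle|^2$. The Local LET (LLET) measures only qubit $A_j$: $C_{LLET}(V)=1-\frac1n\sum_{j=1}^n\mathrm{Tr}\big[(|0\rangle\langle0|^{A_j}\otimes\mathbb 1^{\overline A_j})W|\mathbf 0\rangle\langle\mathbf 0|W^\dagger\big]$, where $\overline A_j$ is all qubits except $A_j$. **Noise types.** For $\mathbf l,\mathbf k\in\{0,1\}^n$ put $X^{\mathbf l}Z^{\mathbf k}=\sigma_x^{l_1}\sigma_z^{k_1}\otimes\cdots\otimes\sigma_x^{l_n}\sigma_z^{k_n}$. (DN) Depolarizing noise: $\rho\mapsto p\rho+(1-p)\mathbb 1/2^n$ for states $\rho$, with $p\in[0,1]$. (PN) Pauli noise: a CPTP map $\mathcal P$ with $\mathcal P(X^{\mathbf l}Z^{\mathbf k})=c_{\mathbf l\mathbf k}X^{\mathbf l}Z^{\mathbf k}$ for all $\mathbf l,\mathbf k$, with $c_{\mathbf 0\mathbf 0}=1$ and all $c_{\mathbf l\mathbf k}\ge 0$. (MN) Measurement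 noise: for each qubit $j$ the projector $|0\rangle\langle0|$ is replaced by $\widetilde P_0^{(j)}=p^{(j)}_{00}|0\rangle\langle0|+p^{(j)}_{01}|1\rangle\langle1|$, where $p^{(j)}_{kl}\in[0,1]$ is the probability of outcome $k$ given input $l$, $p^{(j)}_{00}+p^{(j)}_{10}=1=p^{(j)}_{01}+p^{(j)}_{11}$, $p^{(j)}_{00}>p^{(j)}_{01}$ and $p^{(j)}_{11}>p^{(j)}_{10}$. **Noise Model 3.** Noise acting ''continuously'' means channels interleaved between finitely many time steps; all noise channels and the number $l$ of steps are fixed independently of $V$. For each $V$ a factorization $W=W_l\cdots W_1$ into unitaries is used, and the final state is $$\rho_V=(\mathcal D_l\circ\mathcal W_l\circ\cdots\circ\mathcal D_1\circ\mathcal W_1\circ\mathcal D_0\circ\mathcal P)(|\mathbf 0\rangle\langle\mathbf 0|),$$ with each $\mathcal D_i$ a DN channel on all $n$ qubits and $\mathcal P$ a PN channel (acting at time $\tau_1$, just before $W$). With MN, the noisy costs are $\widetilde C_{LET}(V)=1-\mathrm{Tr}[(\bigotimes_{j=1}^n\widetilde P_0^{(j)})\rho_V]$ and $\widetilde C_{LLET}(V)=1-\frac1n\sum_{j=1}^n\mathrm{Tr}[(\widetilde P_0^{(j)}\otimes\mathbb 1^{\overline A_j})\rho_V]$. **Weak-OPR.** A cost $C$ on $\mathbb V_d$ exhibits weak-OPR to a noise process if the set of minimizers over $\mathbb V_d$ of its noisy version $\widetilde C$ is contained in the set of minimizers of $C$.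
   Formalization: The formal theorem also assumes that every depolarizing parameter p is nonzero and that for each nonzero x in {0,1}^n some k with k·x odd has c_{0k} > 0; without either, non-optimal unitaries also minimize the noisy costs and the claim is false. *)

(* Defs.v *)
From HB Require Import structures.
From mathcomp Require Import all_boot all_order all_algebra.
From mathcomp Require Import spectral.
From mathcomp Require Import complex mxtens.
From mathcomp Require Import boolp classical_sets reals.

Set Implicit Arguments.
Unset Strict Implicit.
Unset Printing Implicit Defensive.

Import Order.TTheory GRing.Theory Num.Theory.

Local Open Scope classical_set_scope.
Local Open Scope ring_scope.
Local Open Scope complex_scope.
Local Open Scope sesquilinear_scope.

(* The basis vector |b_1 ... b_n> of the n-qubit space has the index whose
   binary expansion is b_1 ... b_n, the first qubit being the most significant
   bit. This is the ordering of the iterated Kronecker product. *)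
Definition qbit (n : nat) (a : 'I_(2 ^ n)) (j : 'I_n) : 'I_2 :=
  inZp (a %/ 2 ^ (n - j.+1))%N.

(* The Kronecker products A_1 (x) ... (x) A_n and v_1 (x) ... (x) v_n, given by
   their entries. *)
Definition tensor (R : realType) (n : nat) (A : 'I_n -> 'M[R[i]]_2) :
  'M[R[i]]_(2 ^ n) :=
  \matrix_(a, b) \prod_(j < n) A j (qbit a j) (qbit b j).

Definition tensorv (R : realType) (n : nat) (v : 'I_n -> 'cV[R[i]]_2) :
  'cV[R[i]]_(2 ^ n) :=
  \col_a \prod_(j < n) v j (qbit a j) 0.

Definition ket0 (R : realType) (n : nat) : 'cV[R[i]]_(2 ^ n) :=
  tensorv (fun _ : 'I_n => delta_mx 0 0).

Definition proj0 (R : realType) (n : nat) : 'M[R[i]]_(2 ^ n) :=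
  ket0 R n *m (ket0 R n)^t*.

(* B on qubit A_j, the identity on all the other qubits. *)
Definition on_qubit (R : realType) (n : nat) (j : 'I_n) (B : 'M[R[i]]_2) :
  'M[R[i]]_(2 ^ n) :=
  tensor (fun i => if i == j then B else 1%:M).

Definition unitary_conj (R : realType) (d : nat) (W rho : 'M[R[i]]_d) :
  'M[R[i]]_d := W *m rho *m W^t*.

(* In R[i], 0 <= z means that z is real and nonnegative; so this condition
   also makes A Hermitian. *)
Definition psdmx (R : realType) (d : nat) (A : 'M[R[i]]_d) : Prop :=
  forall v : 'cV[R[i]]_d, 0 <= (v^t* *m A *m v) 0 0.

(* id_m (x) Phi, acting on m x m block matrices with d x d blocks. *)
Definition ampliation (R : realType) (d m : nat)
    (Phi : 'M[R[i]]_d -> 'M[R[i]]_d) (X : 'M[R[i]]_(m * d)) :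
  'M[R[i]]_(m * d) :=
  \sum_(i < m) \sum_(j < m)
    (delta_mx i j *t
       Phi (\matrix_(a < d, b < d) X (mxtens_index (i, a)) (mxtens_index (j, b)))).

Definition cptp (R : realType) (d : nat)
    (Phi : {linear 'M[R[i]]_d -> 'M[R[i]]_d}) : Prop :=
  (forall (m : nat) (X : 'M[R[i]]_(m * d)), psdmx X -> psdmx (ampliation Phi X))
  /\ (forall X : 'M[R[i]]_d, \tr (Phi X) = \tr X).

Definition sigma_x (R : realType) : 'M[R[i]]_2 :=
  \matrix_(i, j) (i != j)%:R.

Definition sigma_z (R : realType) : 'M[R[i]]_2 :=
  \matrix_(i, j) ((-1) ^+ i *+ (i == j)).

Definition bits (n : nat) := {ffun 'I_n -> bool}.

Definition bits0 (n : nat) : bits n := [ffun=> false].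

Definition pauli (R : realType) (n : nat) (l k : bits n) : 'M[R[i]]_(2 ^ n) :=
  tensor (fun j => sigma_x R ^+ l j *m sigma_z R ^+ k j).

(* The trace factor makes this the linear extension of the map
   rho |-> p rho + (1 - p) 1 / 2^n on states. *)
Definition depolarizing (R : realType) (n : nat) (p : R)
    (rho : 'M[R[i]]_(2 ^ n)) : 'M[R[i]]_(2 ^ n) :=
  p%:C *: rho + ((1 - p)%:C * \tr rho / (2 ^ n)%:R) *: 1%:M.

Definition pauli_noise (R : realType) (n : nat)
    (P : {linear 'M[R[i]]_(2 ^ n) -> 'M[R[i]]_(2 ^ n)})
    (c : bits n -> bits n -> R) : Prop :=
  [/\ cptp P,
      forall l k, P (pauli R l k) = (c l k)%:C *: pauli R l k,
      c (bits0 n) (bits0 n) = 1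
    & forall l k, 0 <= c l k].

(* |0^n> is the only eigenvector of P(|0^n><0^n|) = 2^-n sum_k c_{0k} Z^k, up
   to scalars, for its largest eigenvalue: the eigenvalue at |x> is
   2^-n sum_k c_{0k} (-1)^(k.x), and it is less than the one at |0^n> exactly
   when some k with k.x odd has c_{0k} > 0. This holds if all c_{lk} > 0. *)
Definition pauli_nondegenerate (R : realType) (n : nat)
    (c : bits n -> bits n -> R) : Prop :=
  forall x : bits n, x != bits0 n ->
    exists k : bits n, odd #|[set j | k j && x j]%SET| /\ 0 < c (bits0 n) k.

(* pm j k l is the probability of outcome k on qubit j given the input l. *)
Definition measurement_noise (R : realType) (n : nat)
    (pm : 'I_n -> 'M[R]_2) : Prop :=
  forall j : 'I_n,
    [/\ forall k l, 0 <= pm j k l <= 1,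
        forall l, pm j 0 l + pm j 1 l = 1,
        pm j 0 1 < pm j 0 0
      & pm j 1 0 < pm j 1 1].

Definition noisy_P0 (R : realType) (q : 'M[R]_2) : 'M[R[i]]_2 :=
  (q 0 0)%:C *: delta_mx 0 0 + (q 0 1)%:C *: delta_mx 1 1.

(* W_l ... W_1 *)
Fixpoint step_product (R : realType) (d : nat) (W : nat -> 'M[R[i]]_d)
    (l : nat) : 'M[R[i]]_d :=
  if l is l'.+1 then W l *m step_product W l' else 1%:M.

Definition factorization (R : realType) (d : nat) (l : nat)
    (W : nat -> 'M[R[i]]_d) (T : 'M[R[i]]_d) : Prop :=
  (forall i, (1 <= i <= l)%N -> W i \is unitarymx) /\ step_product W l = T.

(* D_l o W_l o ... o D_1 o W_1 o D_0, where D_i is depolarizing with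
   parameter p i. *)
Fixpoint noisy_evolution (R : realType) (n : nat) (p : nat -> R)
    (W : nat -> 'M[R[i]]_(2 ^ n)) (l : nat) (rho : 'M[R[i]]_(2 ^ n)) :
  'M[R[i]]_(2 ^ n) :=
  if l is l'.+1 then
    depolarizing (p l) (unitary_conj (W l) (noisy_evolution p W l' rho))
  else depolarizing (p 0%N) rho.

Definition noisy_state (R : realType) (n : nat)
    (P : 'M[R[i]]_(2 ^ n) -> 'M[R[i]]_(2 ^ n)) (p : nat -> R) (l : nat)
    (W : nat -> 'M[R[i]]_(2 ^ n)) : 'M[R[i]]_(2 ^ n) :=
  noisy_evolution p W l (P (proj0 R n)).

(* The traces below are real; complex.Re only moves them from R[i] to R. *)
Definition C_LET (R : realType) (n : nat) (U V : 'M[R[i]]_(2 ^ n)) : R :=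
  1 - complex.Re (`| ((ket0 R n)^t* *m (V^t* *m U) *m ket0 R n) 0 0 | ^+ 2).

Definition C_LLET (R : realType) (n : nat) (U V : 'M[R[i]]_(2 ^ n)) : R :=
  1 - n%:R^-1 * \sum_(j < n)
    complex.Re (\tr (on_qubit j (delta_mx 0 0) *m
                     unitary_conj (V^t* *m U) (proj0 R n))).

Definition noisy_C_LET (R : realType) (n : nat) (pm : 'I_n -> 'M[R]_2)
    (rho : 'M[R[i]]_(2 ^ n) -> 'M[R[i]]_(2 ^ n)) (V : 'M[R[i]]_(2 ^ n)) : R :=
  1 - complex.Re (\tr (tensor (fun j => noisy_P0 (pm j)) *m rho V)).

Definition noisy_C_LLET (R : realType) (n : nat) (pm : 'I_n -> 'M[R]_2)
    (rho : 'M[R[i]]_(2 ^ n) -> 'M[R[i]]_(2 ^ n)) (V : 'M[R[i]]_(2 ^ n)) : R :=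
  1 - n%:R^-1 * \sum_(j < n)
    complex.Re (\tr (on_qubit j (noisy_P0 (pm j)) *m rho V)).

Definition minimizers (R : realType) (d : nat) (C : 'M[R[i]]_d -> R) :
  set 'M[R[i]]_d :=
  [set V' | V' \is unitarymx /\ forall V, V \is unitarymx -> C V' <= C V].

Definition weak_OPR (R : realType) (d : nat) (C noisyC : 'M[R[i]]_d -> R) :
  Prop := minimizers noisyC `<=` minimizers C.

(* Main.v *)
(* Depolarizing noise commutes with unitary conjugation, so with W = V* U the
   noisy state is q W D W* + r 1, where q > 0 and r do not depend on V and D is
   the image of |0><0| under the Pauli noise. D is diagonal since |0><0| is a
   combination of the Z^k, and its largest eigenvalue is simple and sits at
   |0^n>. In both noisy costs the observable M is also diagonal with a simple
   largest entry at |0^n>. So a minimizer V maximizes tr (M W D W* ), and it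
   suffices to show that then W |0^n> is proportional to |0^n>, as V then makes
   the noiseless cost 0. Put e = |0^n>, v = W e, A = m_max - M and
   B = W (d_max - D) W*, so that A e = 0 and B v = 0. Comparing W with its
   reflections along e + v and e - v yields (v* A v) (e* B e) = 0, so v or W* e
   lies on the line of e. *)
Require Import Defs.
From HB Require Import structures.
From mathcomp Require Import all_boot all_order all_algebra.
From mathcomp Require Import spectral.
From mathcomp Require Import complex.
From mathcomp Require Import reals.
From mathcomp Require Import ring zify.

Set Implicit Arguments.
Unset Strict Implicit.
Unset Printing Implicit Defensive.

Import Order.TTheory GRing.Theory Num.Theory.
Local Open Scope ring_scope.
Local Open Scope sesquilinear_scope.

(** * Reflections and the trace inequality they give *)

Section Reflection.
Variable C : numClosedFieldType.

Lemma adjmxM m n q (A : 'M[C]_(m, n)) (B : 'M[C]_(n, q)) :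
  (A *m B)^t* = B^t* *m A^t*.
Proof. by rewrite trmx_mul map_mxM. Qed.

Lemma adjmxD m n (A B : 'M[C]_(m, n)) : (A + B)^t* = A^t* + B^t*.
Proof. by rewrite linearD /= map_mxD. Qed.

Lemma adjmxZ m n (a : C) (A : 'M[C]_(m, n)) : (a *: A)^t* = a^* *: A^t*.
Proof. by rewrite linearZ /= map_mxZ. Qed.

Lemma adjmx1 n : (1%:M : 'M[C]_n)^t* = 1%:M.
Proof. by rewrite trmx1 map_mx1. Qed.

Lemma sqnorm_sum n (u : 'cV[C]_n) :
  (u^t* *m u) 0 0 = \sum_i `|u i 0| ^+ 2.
Proof. by rewrite mxE; apply: eq_bigr => i _; rewrite !mxE normCKC. Qed.

(* Division by zero makes this coefficient 0 at u = 0, so that the reflection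
   is then the identity, hence still unitary. *)
Definition reflection_coef n (u : 'cV[C]_n) : C := 2 / (u^t* *m u) 0 0.

Definition reflection n (u : 'cV[C]_n) : 'M[C]_n :=
  1%:M - reflection_coef u *: (u *m u^t*).

Lemma reflection_coef_ge0 n (u : 'cV[C]_n) : 0 <= reflection_coef u.
Proof.
rewrite divr_ge0 // sqnorm_sum.
by apply: sumr_ge0 => i _; rewrite exprn_ge0.
Qed.

Lemma reflection_coef_eq0 n (u : 'cV[C]_n) : reflection_coef u = 0 -> u = 0.
Proof.
move/eqP; rewrite mulf_eq0 pnatr_eq0 invr_eq0 /= sqnorm_sum.
rewrite psumr_eq0; last first.
  by move=> i _; rewrite exprn_ge0.
move=> /allP u0; apply/colP => i; rewrite mxE; apply/eqP.
by have := u0 i (mem_index_enum i); rewrite /= sqrf_eq0 normr_eq0.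
Qed.

Lemma reflection_adj n (u : 'cV[C]_n) : (reflection u)^t* = reflection u.
Proof.
rewrite /reflection linearB /= map_mxB adjmx1 adjmxZ adjmxM trmxCK.
by rewrite (conj_Creal (ger0_real (reflection_coef_ge0 u))).
Qed.

Lemma reflection_unitary n (u : 'cV[C]_n) : reflection u \is unitarymx.
Proof.
apply/unitarymxP; rewrite reflection_adj /reflection.
set N := (u^t* *m u) 0 0; set k := reflection_coef u.
(* This identity makes the reflection an involution; at [N] = 0 both sides vanish, because then [k]
   = 2 / 0 = 0. *)
have kN : k * (k * N) = 2 * k.
  rewrite /k /reflection_coef -/N; have [->|N0] := eqVneq N 0.
    by rewrite invr0 !mulr0.
  by field.
have PP : (k *: (u *m u^t*)) *m (k *: (u *m u^t*)) = (2 * k) *: (u *m u^t*).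
  rewrite -scalemxAl -scalemxAr mulmxA -(mulmxA u) [u^t* *m u]mx11_scalar -/N.
  by rewrite mul_mx_scalar -scalemxAl !scalerA kN.
rewrite mulmxBl mul1mx mulmxBr mulmx1 PP mulr2n mulrDl mul1r scalerDl.
by rewrite opprB addrK subrK.
Qed.

Lemma adjmx_mul_unitary n (V U : 'M[C]_n) :
  V \is unitarymx -> U \is unitarymx -> V^t* *m U \is unitarymx.
Proof. by move=> Vu Uu; apply: mul_unitarymx Uu; rewrite trmxC_unitary. Qed.

Lemma trace_rank1 n (A : 'M[C]_n) (u v : 'cV[C]_n) :
  \tr (A *m (u *m v^t*)) = (v^t* *m A *m u) 0 0.
Proof. by rewrite mulmxA mxtrace_mulC mulmxA /mxtrace big_ord1. Qed.

(** Since the matrix u u* has rank one, the term quadratic in [k] splits into the product of the two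
    forms at [u]. *)
Lemma trace_reflection n (A B : 'M[C]_n) (u : 'cV[C]_n) :
  let k := reflection_coef u in
  \tr (A *m (reflection u *m B *m (reflection u)^t*)) =
  \tr (A *m B) - k * (u^t* *m (B *m A) *m u) 0 0
  - k * (u^t* *m (A *m B) *m u) 0 0
  + k ^+ 2 * ((u^t* *m A *m u) 0 0 * (u^t* *m B *m u) 0 0).
Proof.
move=> k; rewrite reflection_adj /reflection -/k.
rewrite mulmxBl mul1mx mulmxBr mulmx1 -scalemxAl -scalemxAr mulmxBl -scalemxAl.
rewrite !mulmxBr -!scalemxAr mulmxBr -scalemxAr.
rewrite !raddfB /= !mxtraceZ.
rewrite -!trace_rank1.
have -> : \tr (A *m (u *m u^t* *m B)) = \tr (B *m A *m (u *m u^t*)).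
  by rewrite mulmxA mxtrace_mulC !mulmxA.
have -> : \tr (A *m (u *m u^t* *m B *m (u *m u^t*))) =
    \tr (A *m (u *m u^t*)) * \tr (B *m (u *m u^t*)).
  have -> : A *m (u *m u^t* *m B *m (u *m u^t*)) =
      A *m u *m (u^t* *m B *m u) *m u^t* by rewrite !mulmxA.
  rewrite (trace_rank1 B) [u^t* *m B *m u in LHS]mx11_scalar mul_mx_scalar.
  by rewrite -scalemxAl linearZ /= [RHS]mulrC mulmxA.
by rewrite (mulmxA A B); ring.
Qed.

Lemma form_adj n (A : 'M[C]_n) (u v : 'cV[C]_n) :
  ((u^t* *m A *m v) 0 0)^* = (v^t* *m A^t* *m u) 0 0.
Proof.
transitivity (((u^t* *m A *m v)^t*) 0 0); first by rewrite !mxE.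
by rewrite !adjmxM trmxCK mulmxA.
Qed.

(* Reflecting along u = e + s v with s = 1 or s = -1 changes the trace by
   k^2 (v* A v) (e* B e) - 2 k s Re (v* A B e); the sign s can be chosen so
   that the last term is nonnegative. *)
Lemma reflection_maximum n (A B : 'M[C]_n) (e v : 'cV[C]_n) :
  A^t* = A -> B^t* = B -> A *m e = 0 -> B *m v = 0 ->
  0 <= (v^t* *m A *m v) 0 0 -> 0 <= (e^t* *m B *m e) 0 0 ->
  (forall H, H \is unitarymx ->
     \tr (A *m (H *m B *m H^t*)) <= \tr (A *m B)) ->
  (v^t* *m A *m v) 0 0 * (e^t* *m B *m e) 0 0 = 0.
Proof.
move=> Ah Bh Ae Bv a0 b0 maxH.
set z := (v^t* *m (A *m B) *m e) 0 0.
have eA : e^t* *m A = 0 by rewrite -Ah -adjmxM Ae trmx0 map_mx0.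
have vB : v^t* *m B = 0 by rewrite -Bh -adjmxM Bv trmx0 map_mx0.
have rt : z + z^* \is Num.real by rewrite CrealE rmorphD /= conjCK addrC.
have [s s2 [sr st]] : exists2 s : C, s ^+ 2 = 1 & s^* = s /\ s * (z + z^*) <= 0.
  have /orP[t0|t0] : (0 <= z + z^*) || (z + z^* <= 0) by [].
    exists (- 1); first by rewrite sqrrN expr1n.
    by rewrite rmorphN rmorph1 mulN1r oppr_le0.
  by exists 1; [rewrite expr1n | rewrite rmorph1 mul1r].
pose u := e + s *: v.
have Au : A *m u = s *: (A *m v) by rewrite mulmxDr Ae add0r scalemxAr.
have Bu : B *m u = B *m e by rewrite mulmxDr -scalemxAr Bv scaler0 addr0.
have us : u^t* = e^t* + s *: v^t* by rewrite adjmxD adjmxZ sr.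
have uA : u^t* *m A = s *: (v^t* *m A) by rewrite us mulmxDl eA add0r scalemxAl.
have uB : u^t* *m B = e^t* *m B.
  by rewrite us mulmxDl -scalemxAl vB scaler0 addr0.
have uAu : (u^t* *m A *m u) 0 0 = (v^t* *m A *m v) 0 0.
  rewrite -mulmxA Au -scalemxAr mulmxA uA -scalemxAl scalerA -expr2 s2.
  by rewrite scale1r.
have uBu : (u^t* *m B *m u) 0 0 = (e^t* *m B *m e) 0 0.
  by rewrite -mulmxA Bu mulmxA uB.
have uABu : (u^t* *m (A *m B) *m u) 0 0 = s * z.
  by rewrite -!mulmxA Bu mulmxA uA -scalemxAl [LHS]mxE /z !mulmxA.
have uBAu : (u^t* *m (B *m A) *m u) 0 0 = s * z^*.
  rewrite -!mulmxA Au mulmxA uB -scalemxAr [LHS]mxE /z form_adj adjmxM Ah Bh.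
  by rewrite !mulmxA.
have := maxH _ (reflection_unitary u).
rewrite trace_reflection uAu uBu uABu uBAu.
have := reflection_coef_ge0 u.
(* At [u] = 0 the reflection is the identity and maximality says nothing, but then v* A v = u* A u =
   0. *)
rewrite le_eqVlt => /orP[/eqP/esym/reflection_coef_eq0 u0 _|k0].
  by rewrite -uAu u0 mulmx0 mxE mul0r.
set k := reflection_coef u; set X := (v^t* *m A *m v) 0 0 * _ => le.
have X0 : 0 <= X by rewrite mulr_ge0.
(* Maximality gives k^2 X <= 2 k s Re z <= 0 with k > 0, hence X <= 0. *)
apply/eqP; rewrite eq_le X0 andbT -(pmulr_rle0 _ (exprn_gt0 2 k0)) -/k.
have : 0 <= k * (s * (z + z^*)) - k ^+ 2 * X.
  by move: le; rewrite -subr_ge0; congr (is_true (0 <= _)); ring.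
rewrite subr_ge0 => /le_trans; apply; by rewrite pmulr_rle0.
Qed.

(** * Traces and forms of diagonal matrices *)

(** The trace thus depends on [T] only through the matrix of the |T y x|^2, which is doubly
    stochastic when [T] is unitary. *)
Lemma mulmx_diag_trace n (a b : 'rV[C]_n) (T : 'M[C]_n) :
  \tr (diag_mx a *m (T *m diag_mx b *m T^t*)) =
  \sum_y \sum_x a 0 y * b 0 x * `|T y x| ^+ 2.
Proof.
rewrite /mxtrace; apply: eq_bigr => y _.
rewrite mul_diag_mx !mxE mulr_sumr; apply: eq_bigr => x _.
rewrite mul_mx_diag !mxE normCK; ring.
Qed.

Lemma unitary_row_norm n (T : 'M[C]_n) y : T \is unitarymx ->
  \sum_x `|T y x| ^+ 2 = 1.
Proof.
move=> /unitarymxP/matrixP/(_ y y); rewrite !mxE eqxx mulr1n => <-.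
by apply: eq_bigr => x _; rewrite !mxE normCK.
Qed.

Lemma unitary_col_norm n (T : 'M[C]_n) x : T \is unitarymx ->
  \sum_y `|T y x| ^+ 2 = 1.
Proof.
rewrite -trmxC_unitary => /(unitary_row_norm x) <-.
by apply: eq_bigr => y _; rewrite !mxE norm_conjC.
Qed.

Lemma unitary_entry_le1 n (T : 'M[C]_n) y x : T \is unitarymx -> `|T y x| <= 1.
Proof.
move=> Tu; rewrite -(@expr_le1 _ 2) // -(unitary_row_norm y Tu) (bigD1 x) //=.
by rewrite lerDl sumr_ge0 // => i _; rewrite exprn_ge0.
Qed.

Lemma diag_adj n (a : 'rV[C]_n) : (forall x, a 0 x \is Num.real) ->
  (diag_mx a)^t* = diag_mx a.
Proof.
move=> ar; apply/matrixP => x y; rewrite !mxE eq_sym.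
case: eqVneq => [->|_]; last by rewrite !mulr0n rmorph0.
by rewrite !mulr1n conj_Creal.
Qed.

Lemma diag_form n (a : 'rV[C]_n) (v : 'cV[C]_n) :
  (v^t* *m diag_mx a *m v) 0 0 = \sum_x a 0 x * `|v x 0| ^+ 2.
Proof.
rewrite -mulmxA mul_diag_mx mxE; apply: eq_bigr => x _.
by rewrite !mxE normCKC; ring.
Qed.

Lemma diag_delta n (a : 'rV[C]_n) o : a 0 o = 0 ->
  diag_mx a *m delta_mx o (0 : 'I_1) = 0.
Proof.
move=> ao; rewrite mul_diag_mx; apply/matrixP => x y; rewrite !mxE.
by case: eqVneq => [->|_]; rewrite ?ao ?mul0r // mulr0.
Qed.

(** A vanishing sum of nonnegative terms vanishes termwise, and the weights off [o] are positive. So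
    [v] lies on the line of the basis vector at [o]. *)
Lemma diag_form_eq0 n (a : 'rV[C]_n) (v : 'cV[C]_n) o :
  a 0 o = 0 -> (forall x, x != o -> 0 < a 0 x) ->
  (v^t* *m diag_mx a *m v) 0 0 = 0 -> forall x, x != o -> v x 0 = 0.
Proof.
move=> ao ap; rewrite diag_form => /eqP; rewrite psumr_eq0; last first.
  move=> x _; rewrite mulr_ge0 ?exprn_ge0 //.
  by have [->|/ap/ltW//] := eqVneq x o; rewrite ao.
move=> /allP h x xo; have := h x (mem_index_enum x).
by rewrite /= mulf_eq0 gt_eqF ?ap //= sqrf_eq0 normr_eq0 => /eqP.
Qed.

Lemma diag_trace_maximum n (m b : 'rV[C]_n) (o : 'I_n) (T : 'M[C]_n) :
  (forall y, y != o -> m 0 y < m 0 o) -> (forall x, x != o -> b 0 x < b 0 o) ->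
  T \is unitarymx ->
  (forall T', T' \is unitarymx ->
     \tr (diag_mx m *m (T' *m diag_mx b *m T'^t*)) <=
     \tr (diag_mx m *m (T *m diag_mx b *m T^t*))) ->
  `|T o o| = 1.
Proof.
move=> mo bo Tu maxT.
(* [a'] and [b'] are the gaps below the largest entries: nonnegative, and zero only at [o]. *)
pose a' : 'rV_n := const_mx (m 0 o) - m.
pose b' : 'rV_n := const_mx (b 0 o) - b.
have a'o : a' 0 o = 0 by rewrite !mxE subrr.
have b'o : b' 0 o = 0 by rewrite !mxE subrr.
have a'p y : y != o -> 0 < a' 0 y by move=> /mo; rewrite !mxE subr_gt0.
have b'p y : y != o -> 0 < b' 0 y by move=> /bo; rewrite !mxE subr_gt0.
have a'0 y : 0 <= a' 0 y by have [->|/a'p/ltW//] := eqVneq y o; rewrite a'o.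
have b'0 y : 0 <= b' 0 y by have [->|/b'p/ltW//] := eqVneq y o; rewrite b'o.
pose e : 'cV[C]_n := delta_mx o 0; pose v := T *m e.
pose B := T *m diag_mx b' *m T^t*.
have TT : T^t* *m T = 1%:M.
  by have := Tu; rewrite -trmxC_unitary => /unitarymxP; rewrite trmxCK.
have Ah : (diag_mx a')^t* = diag_mx a'.
  by apply: diag_adj => x; rewrite ger0_real.
have Bh : B^t* = B.
  by rewrite !adjmxM trmxCK diag_adj ?mulmxA // => x; rewrite ger0_real.
have Bv : B *m v = 0.
  by rewrite /B /v -mulmxA (mulmxA _ T) TT mul1mx -mulmxA diag_delta // mulmx0.
have eBe : (e^t* *m B *m e) 0 0 =
    ((T^t* *m e)^t* *m diag_mx b' *m (T^t* *m e)) 0 0.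
  by rewrite adjmxM trmxCK /B !mulmxA.
(* Passing to the gaps reverses both signs, so it shifts the objective by a constant: the terms
   containing only one of [m] and [b] do not depend on [T'], as the |T' y x|^2 have row and column
   sums 1. *)
have objE T' : T' \is unitarymx ->
   \tr (diag_mx a' *m (T' *m diag_mx b' *m T'^t*)) =
   \sum_y (m 0 o - m 0 y) * b 0 o - m 0 o * \sum_x b 0 x +
   \tr (diag_mx m *m (T' *m diag_mx b *m T'^t*)).
  move=> T'u; rewrite !mulmx_diag_trace.
  have -> : m 0 o * \sum_x b 0 x = \sum_y \sum_x m 0 o * b 0 x * `|T' y x| ^+ 2.
    rewrite exchange_big mulr_sumr; apply: eq_bigr => x _.
    by rewrite -mulr_sumr unitary_col_norm ?mulr1.
  rewrite -sumrB -big_split /=; apply: eq_bigr => y _.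
  rewrite -[X in X - _]mulr1 -(unitary_row_norm y T'u) mulr_sumr.
  rewrite -sumrB -big_split /=.
  apply: eq_bigr => x _; rewrite !mxE; ring.
have form_ge0 (w : 'rV[C]_n) (u : 'cV[C]_n) : (forall x, 0 <= w 0 x) ->
    0 <= (u^t* *m diag_mx w *m u) 0 0.
  move=> w0; rewrite diag_form sumr_ge0 // => x _.
  by rewrite mulr_ge0 ?exprn_ge0.
have /eqP : (v^t* *m diag_mx a' *m v) 0 0 * (e^t* *m B *m e) 0 0 = 0.
  apply: reflection_maximum => //; rewrite ?eBe ?form_ge0 ?diag_delta //.
  (* Conjugating [B] by [H] replaces [T] by [H *m T], which is again a competitor. *)
  move=> H Hu; have HTu : H *m T \is unitarymx by rewrite mul_unitarymx.
  have -> : H *m B *m H^t* = (H *m T) *m diag_mx b' *m (H *m T)^t*.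
    by rewrite /B adjmxM !mulmxA.
  by rewrite !objE // lerD2l maxT.
have norm1 (u : 'I_n -> C) : (forall x, x != o -> u x = 0) ->
    \sum_x `|u x| ^+ 2 = 1 -> `|u o| = 1.
  move=> u0; rewrite (bigD1 o) //= big1 ?addr0; last first.
    by move=> x /u0 ->; rewrite normr0 expr0n.
  by move=> /eqP; rewrite sqrp_eq1 // => /eqP.
(* Either column [o] or row [o] of [T] is supported at [o] alone; as it has norm 1, its entry there
   has modulus 1. *)
rewrite eBe mulf_eq0 => /orP[] /eqP z.
- apply: (norm1 (T^~ o)) (unitary_col_norm o Tu) => y.
  by move=> /(diag_form_eq0 a'o a'p z); rewrite /v -colE mxE.
- apply: (norm1 (T o)) (unitary_row_norm o Tu) => x.
  move=> /(diag_form_eq0 b'o b'p z); rewrite -colE !mxE => /eqP.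
  by rewrite conjC_eq0 => /eqP.
Qed.
End Reflection.

(** * Basis indices and their binary digits *)

(** Induction on [n] peels off the least significant digit; halving shifts the other digits down by
    one place. *)
Lemma binary_digits_inj n (a b : nat) : (a < 2 ^ n)%N -> (b < 2 ^ n)%N ->
  (forall k, (k < n)%N -> (a %/ 2 ^ k) %% 2 = (b %/ 2 ^ k) %% 2)%N -> a = b.
Proof.
elim: n a b => [|n IH] a b; first by case: a b => [|a] [|b].
rewrite !expnS => an bn ab.
have h : (a %/ 2 = b %/ 2)%N.
  apply: IH => [||k kn]; rewrite ?ltn_divLR // 1?mulnC //.
  by have := ab k.+1 kn; rewrite expnS !divnMA.
rewrite (divn_eq a 2) (divn_eq b 2) h.
by have := ab 0%N isT; rewrite !divn1 => ->.
Qed.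

Lemma qbit_inj n (a b : 'I_(2 ^ n)) : (forall j, qbit a j = qbit b j) -> a = b.
Proof.
move=> ab; apply/val_inj/(binary_digits_inj (ltn_ord a) (ltn_ord b)) => k kn.
(* Qubits are counted from the most significant bit, so the digit of weight 2^k belongs to qubit n -
   k.+1. *)
have nk : (n - k.+1 < n)%N by lia.
have := congr1 val (ab (Ordinal nk)); rewrite /=.
by have -> : (n - (n - k.+1).+1 = k)%N by lia.
Qed.

Definition index0 n : 'I_(2 ^ n) := Ordinal (expn_gt0 2 n).

Lemma qbit_index0 n (j : 'I_n) : qbit (index0 n) j = 0.
Proof. by apply/val_inj; rewrite /= div0n mod0n. Qed.

Lemma qbit_neq0 n (a : 'I_(2 ^ n)) : a != index0 n -> exists j, qbit a j = 1.
Proof.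
move=> a0; have /existsP[j aj] : [exists j, qbit a j != 0].
  rewrite -negb_forall; apply: contra a0 => /forallP h; apply/eqP/qbit_inj => j.
  by rewrite qbit_index0; apply/eqP.
by exists j; move: aj; case: (qbit a j) => -[|[|]] //= i _; apply/val_inj.
Qed.

(** * Tensor products of diagonal matrices *)

Section Qubits.
Variables (R : realType) (n : nat).
Local Notation C := R[i].
Local Notation o := (index0 n).

(** The qubits determine the index, so the Kronecker delta factors over them; this is how tensor
    products below are recognized as diagonal. *)
Lemma prod_qbit_eq (a b : 'I_(2 ^ n)) :
  \prod_(j < n) (qbit a j == qbit b j)%:R = (a == b)%:R :> C.
Proof.
have [->|ab] := eqVneq a b; first by rewrite big1 // => j _; rewrite eqxx.
have [j jP] : exists j, qbit a j != qbit b j.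
  apply/existsP; rewrite -negb_forall; apply: contra ab => /forallP h.
  by apply/eqP/qbit_inj => j; apply/eqP.
by rewrite (bigD1 j) //= (negPf jP) mul0r.
Qed.

Lemma tensor_diag (d : 'I_n -> 'rV[C]_2) :
  tensor (fun j => diag_mx (d j)) =
  diag_mx (\row_a \prod_(j < n) d j 0 (qbit a j)).
Proof.
apply/matrixP => a b; rewrite !mxE -mulr_natr -prod_qbit_eq -big_split /=.
by apply: eq_bigr => j _; rewrite !mxE mulr_natr.
Qed.

Lemma eq_tensor (A B : 'I_n -> 'M[C]_2) : A =1 B -> tensor A = tensor B.
Proof.
move=> AB; apply/matrixP => a b; rewrite !mxE.
by apply: eq_bigr => j _; rewrite AB.
Qed.

Lemma ket0E : ket0 R n = delta_mx o 0.
Proof.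
apply/colP => a; rewrite !mxE eqxx andbT -prod_qbit_eq.
by apply: eq_bigr => j _; rewrite mxE qbit_index0 eqxx andbT.
Qed.

Lemma proj0E : proj0 R n = diag_mx (delta_mx 0 o).
Proof.
rewrite /proj0 ket0E; apply/matrixP => a b.
rewrite mxE big_ord1 !mxE !eqxx !andbT /=.
rewrite rmorph_nat -natrM; have [->|ab] := eqVneq a b; first by case: (b == o).
rewrite mulr0n; have [bo|_] := eqVneq b o; last by rewrite muln0.
by rewrite -bo (negPf ab).
Qed.

Lemma noisy_P0E (q : 'M[R]_2) : noisy_P0 q = diag_mx (\row_x (q 0 x)%:C%C).
Proof.
apply/matrixP => x y; rewrite !mxE.
have E z : z = 0 :> 'I_2 \/ z = 1.
  by case: z => -[|[|]] // i; [left|right]; apply/val_inj.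
by case: (E x) => ->; case: (E y) => -> /=; rewrite ?mulr1 ?mulr0 ?addr0 ?add0r.
Qed.

Lemma on_qubit_diag (j : 'I_n) (d : 'rV[C]_2) :
  on_qubit j (diag_mx d) = diag_mx (\row_a d 0 (qbit a j)).
Proof.
rewrite /on_qubit.
(* The identity factors become diagonal matrices of ones, so that [tensor_diag] applies. *)
rewrite (@eq_tensor _ (fun i => diag_mx (if i == j then d else const_mx 1))).
  rewrite tensor_diag; congr diag_mx; apply/rowP => a; rewrite !mxE.
  by rewrite (bigD1 j) //= eqxx big1 ?mulr1 // => i /negPf ->; rewrite mxE.
by move=> i; case: ifP => // _; rewrite diag_const_mx.
Qed.

(** * Pauli strings in Z and the noisy input state *)

Lemma sigma_z_exp (b : bool) :
  sigma_z R ^+ b = diag_mx (\row_x (-1) ^+ (b && (x == 1))).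
Proof.
apply/matrixP => x y; case: b; rewrite ?expr1 ?expr0 !mxE ?expr0 //.
by case: x => -[|[|]].
Qed.

(** The character (-1)^(k.x) at the bits x of [a], which is the eigenvalue of Z^k at |x>. The
    exponent is the parity occurring in [pauli_nondegenerate]. *)
Definition character (k : bits n) (a : 'I_(2 ^ n)) : C :=
  (-1) ^+ odd #|[set j | k j && (qbit a j == 1)]|.

Lemma character_prod k a :
  character k a = \prod_(j < n) (-1) ^+ (k j && (qbit a j == 1)).
Proof.
rewrite /character signr_odd -expr_sum; congr (_ ^+ _).
by rewrite -sum1_card big_mkcond; apply: eq_bigr => j _; rewrite inE; case: andb.
Qed.

Lemma pauli_z k : pauli R (bits0 n) k = diag_mx (\row_a character k a).
Proof.
rewrite /pauli.
rewrite (@eq_tensor _ (fun j => diag_mx (\row_x (-1) ^+ (k j && (x == 1))))).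
  rewrite tensor_diag; congr diag_mx; apply/rowP => a.
  rewrite !mxE character_prod.
  by apply: eq_bigr => j _; rewrite mxE.
by move=> j; rewrite ffunE expr0 mul1mx sigma_z_exp.
Qed.

(** The sum over [k] factors into the product over the qubits of 1 + (-1)^(x_j), which is 2 for bit
    0 and 0 for bit 1. *)
Lemma sum_character a : \sum_k character k a = (2 ^ n)%:R * (a == o)%:R.
Proof.
under eq_bigr => k _ do rewrite character_prod.
rewrite -(bigA_distr_bigA (fun j (b : bool) => (-1) ^+ (b && (qbit a j == 1)) : C)).
rewrite -prod_qbit_eq natrX -[X in 2 ^+ X]card_ord -prodr_const -big_split /=.
apply: eq_bigr => j _; rewrite big_bool qbit_index0 /=.
by case: (qbit a j) => -[|[|]] //= i; rewrite ?expr0 ?expr1 ?mulr1 ?mulr0 ?addNr.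
Qed.

(** The noise is specified on Pauli strings only; this expansion determines its value on |0><0|. *)
Lemma proj0_pauli :
  proj0 R n = (2 ^ n)%:R^-1 *: \sum_k pauli R (bits0 n) k.
Proof.
under eq_bigr => k _ do rewrite pauli_z.
rewrite -linear_sum -linearZ /= proj0E; congr diag_mx; apply/rowP => a.
rewrite !mxE summxE; under eq_bigr => k _ do rewrite mxE.
by rewrite sum_character mulKf // pnatr_eq0 -lt0n expn_gt0.
Qed.

(** The eigenvalues of the noisy input: up to 2^-n, the Walsh-Hadamard transform of the c_{0k}. *)
Definition pauli_spectrum (c : bits n -> bits n -> R) : 'rV[C]_(2 ^ n) :=
  \row_a ((2 ^ n)%:R^-1 * \sum_k (c (bits0 n) k)%:C%C * character k a).

Lemma pauli_noise_proj0 (P : {linear 'M[C]_(2 ^ n) -> 'M[C]_(2 ^ n)}) c :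
  pauli_noise P c -> P (proj0 R n) = diag_mx (pauli_spectrum c).
Proof.
move=> [_ Pc _ _]; rewrite proj0_pauli linearZ linear_sum /=.
under eq_bigr => k _ do rewrite Pc pauli_z -linearZ.
rewrite -linear_sum -linearZ; congr diag_mx; apply/rowP => a.
by rewrite !mxE summxE; congr (_ * _); apply: eq_bigr => k _; rewrite !mxE.
Qed.

(** Every character is 1 at [o], so the gap is 2^-n times the sum of c_{0k} (1 - (-1)^(k.x)). No
    term is negative, and the [k] supplied by nondegeneracy contributes 2 c_{0k} > 0. *)
Lemma pauli_spectrum_max P c (a : 'I_(2 ^ n)) : pauli_noise P c ->
  pauli_nondegenerate c -> a != o ->
  pauli_spectrum c 0 a < pauli_spectrum c 0 o.
Proof.
move=> [_ _ _ c0] cn a0; rewrite !mxE ltr_pM2l; last first.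
  by rewrite invr_gt0 ltr0n expn_gt0.
pose x : bits n := [ffun j => qbit a j == 1].
have x0 : x != bits0 n.
  have [j aj] := qbit_neq0 a0; apply/eqP => /ffunP/(_ j).
  by rewrite !ffunE aj eqxx.
have [k [ok ck]] := cn x x0.
have ch0 k' : character k' o = 1.
  rewrite character_prod big1 // => j _.
  by rewrite qbit_index0 andbF.
rewrite -subr_gt0 -sumrB (bigD1 k) //=; apply: ltr_wpDr.
  apply: sumr_ge0 => k' _; rewrite ch0 -mulrBr mulr_ge0 ?lecR ?c0 //.
  by rewrite /character; case: odd; rewrite ?opprK ?subrr // addr_ge0.
rewrite ch0 -mulrBr mulr_gt0 ?ltcR // /character.
set s := odd _; have -> : s = true; last by rewrite opprK addr_gt0.
by rewrite -ok /s; congr odd; apply: eq_card => j; rewrite !inE ffunE.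
Qed.


(** * Merging the depolarizing channels *)

Lemma unitary_conj_trace (W rho : 'M[C]_(2 ^ n)) : W \is unitarymx ->
  \tr (unitary_conj W rho) = \tr rho.
Proof.
rewrite -trmxC_unitary => /unitarymxP; rewrite trmxCK => WW.
by rewrite /unitary_conj -mulmxA mxtrace_mulC -mulmxA WW mulmx1.
Qed.

Lemma depolarizing_trace (q : R) (rho : 'M[C]_(2 ^ n)) :
  \tr (depolarizing q rho) = \tr rho.
Proof.
rewrite /depolarizing linearD /= !linearZ /= mxtrace1.
rewrite divfK; last by rewrite pnatr_eq0 -lt0n expn_gt0.
by rewrite rmorphB rmorph1; ring.
Qed.

Lemma step_product_unitary l (W : nat -> 'M[C]_(2 ^ n)) :
  (forall i, (1 <= i <= l)%N -> W i \is unitarymx) ->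
  step_product W l \is unitarymx.
Proof.
elim: l => [|l IH] Wu /=; first by apply/unitarymxP; rewrite adjmx1 mulmx1.
apply: mul_unitarymx; first by apply: Wu; rewrite leqnn.
by apply: IH => i /andP[i1 il]; apply: Wu; rewrite i1 leqW.
Qed.

Lemma unitary_conjM (A B rho : 'M[C]_(2 ^ n)) :
  unitary_conj A (unitary_conj B rho) = unitary_conj (A *m B) rho.
Proof. by rewrite /unitary_conj adjmxM !mulmxA. Qed.

(** Conjugation fixes the identity and preserves the trace, so the noise can be moved past every
    unitary. *)
Lemma depolarizing_conj (q : R) (A rho : 'M[C]_(2 ^ n)) : A \is unitarymx ->
  unitary_conj A (depolarizing q rho) = depolarizing q (unitary_conj A rho).
Proof.
move=> Au; rewrite [RHS]/depolarizing unitary_conj_trace // /depolarizing.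
rewrite /unitary_conj mulmxDr mulmxDl -!scalemxAr -!scalemxAl mulmx1.
by rewrite (unitarymxP Au).
Qed.

(** The weights of the maximally mixed part add up to t (1 - q) + (1 - t) = 1 - q t. *)
Lemma depolarizingM (q t : R) (rho : 'M[C]_(2 ^ n)) :
  depolarizing t (depolarizing q rho) = depolarizing (q * t) rho.
Proof.
rewrite [LHS]/depolarizing depolarizing_trace /depolarizing.
rewrite scalerDr !scalerA -addrA -scalerDl -rmorphM mulrC.
suff -> : t%:C%C * ((1 - q)%:C%C * \tr rho / (2 ^ n)%:R) +
    (1 - t)%:C%C * \tr rho / (2 ^ n)%:R =
    (1 - q * t)%:C%C * \tr rho / (2 ^ n)%:R by [].
by rewrite !rmorphB !rmorphM rmorph1; ring.
Qed.

(** Once all the noise is moved to the end, the factorization matters only through its product. The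
    range [l.+1] counts the channels D_0, ..., D_l. *)
Lemma noisy_evolutionE l p (W : nat -> 'M[C]_(2 ^ n)) rho :
  (forall i, (1 <= i <= l)%N -> W i \is unitarymx) ->
  noisy_evolution p W l rho =
  depolarizing (\prod_(i < l.+1) p i) (unitary_conj (step_product W l) rho).
Proof.
elim: l => [|l IH] Wu.
  by rewrite /= big_ord1 /unitary_conj adjmx1 mul1mx mulmx1.
have Wul i : (1 <= i <= l)%N -> W i \is unitarymx.
  by move=> /andP[i1 il]; rewrite Wu // i1 leqW.
have Wl : W l.+1 \is unitarymx by rewrite Wu ?leqnn.
rewrite big_ord_recr -depolarizingM -[step_product W l.+1]/(W l.+1 *m _).
by rewrite -unitary_conjM -(depolarizing_conj _ _ Wl) -IH.
Qed.

(** * Maximizers of a noisy diagonal observable *)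

(** The order of [R[i]] also compares imaginary parts; realness lets inequalities between real parts
    be lifted to it. *)
Lemma weighted_trace_real (m b : 'rV[C]_(2 ^ n)) (T : 'M[C]_(2 ^ n)) :
  (forall y, m 0 y \is Num.real) -> (forall x, b 0 x \is Num.real) ->
  \tr (diag_mx m *m (T *m diag_mx b *m T^t*)) \is Num.real.
Proof.
move=> mr br; rewrite mulmx_diag_trace; apply: rpred_sum => y _.
by apply: rpred_sum => x _; rewrite !realM // realX // normr_real.
Qed.

Lemma pauli_spectrum_real c x : pauli_spectrum c 0 x \is Num.real.
Proof.
rewrite mxE realM ?realV ?realn //; apply: rpred_sum => k _.
by rewrite realM ?complex_real // /character realX // realN real1.
Qed.

(** Serves both costs: [m] is the diagonal of the observable, a product over the qubits for LET and
    a sum for LLET. *)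
Lemma noisy_optimum (P : {linear 'M[C]_(2 ^ n) -> 'M[C]_(2 ^ n)}) c l
    (p : nat -> R)
    (W : 'M[C]_(2 ^ n) -> nat -> 'M[C]_(2 ^ n)) (U V : 'M[C]_(2 ^ n))
    (m : 'I_(2 ^ n) -> R) :
  pauli_noise P c -> pauli_nondegenerate c ->
  (forall i, (i <= l)%N -> 0 < p i) ->
  (forall V, V \is unitarymx -> factorization l (W V) (V^t* *m U)) ->
  U \is unitarymx -> V \is unitarymx ->
  (forall a, a != o -> m a < m o) ->
  (forall V', V' \is unitarymx ->
     complex.Re (\tr (diag_mx (\row_a (m a)%:C%C) *m noisy_state P p l (W V'))) <=
     complex.Re (\tr (diag_mx (\row_a (m a)%:C%C) *m noisy_state P p l (W V)))) ->
  `|(V^t* *m U) o o| = 1.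
Proof.
move=> hP cn p0 hW Uu Vu mo maxV.
set M := diag_mx _ in maxV; set b := pauli_spectrum c.
set q := \prod_(i < l.+1) p i.
have q0 : 0 < q by apply: prodr_gt0 => i _; apply: p0; rewrite -ltnS.
have mr (y : 'I_(2 ^ n)) : (\row_a (m a)%:C%C : 'rV[C]__) 0 y \is Num.real.
  by rewrite mxE complex_real.
(* The second summand comes from the maximally mixed part and does not depend on [V']. *)
have objE (V' : 'M_(2 ^ n)) : V' \is unitarymx ->
    complex.Re (\tr (M *m noisy_state P p l (W V'))) =
    q * complex.Re (\tr (M *m ((V'^t* *m U) *m diag_mx b *m (V'^t* *m U)^t*))) +
    complex.Re (\tr (M *m (((1 - q)%:C%C * \tr (diag_mx b) / (2 ^ n)%:R) *: 1%:M))).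
  move=> V'u; have [Wu <-] := hW _ V'u.
  rewrite /noisy_state (pauli_noise_proj0 hP) noisy_evolutionE // -/q -/b.
  have Su := step_product_unitary Wu.
  rewrite /depolarizing unitary_conj_trace // mulmxDr linearD /=.
  rewrite -scalemxAr linearZ /=.
  rewrite raddfD /= /unitary_conj; congr (_ + _).
  by case: (\tr _) => x y /=; rewrite mul0r subr0.
apply: (@diag_trace_maximum _ _ (\row_a (m a)%:C%C) b).
- by move=> y /mo; rewrite !mxE ltcR.
- by move=> x; apply: pauli_spectrum_max hP cn.
- exact: adjmx_mul_unitary Vu Uu.
(* Every unitary [T] is attained by some trainable unitary, so maximality over [V] is maximality
   over all [T]. *)
- move=> T Tu; pose V' := U *m T^t*.
  have V'u : V' \is unitarymx.
    by apply: (mul_unitarymx Uu); rewrite trmxC_unitary.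
  have VT : V'^t* *m U = T.
    rewrite adjmxM trmxCK -mulmxA.
    have := Uu; rewrite -trmxC_unitary => /unitarymxP; rewrite trmxCK => ->.
    by rewrite mulmx1.
  have br := pauli_spectrum_real c.
  rewrite -(RRe_real (weighted_trace_real _ mr br)).
  rewrite -[X in _ <= X](RRe_real (weighted_trace_real _ mr br)) lecR.
  have := maxV _ V'u.
  by rewrite (objE _ V'u) (objE _ Vu) VT lerD2r (ler_pM2l q0).
Qed.

(** * Minimizers of the noiseless costs *)

Lemma ket0_overlap (T : 'M[C]_(2 ^ n)) :
  ((ket0 R n)^t* *m T *m ket0 R n) 0 0 = T o o.
Proof.
rewrite ket0E -colE mxE [LHS]mxE (bigD1 o) //= big1 => [|a /negPf ao].
  by rewrite !mxE !eqxx rmorph1 mul1r addr0.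
by rewrite !mxE ao rmorph0 mul0r.
Qed.

Lemma qubit0_probability (j : 'I_n) (T : 'M[C]_(2 ^ n)) :
  \tr (on_qubit j (delta_mx 0 0) *m unitary_conj T (proj0 R n)) =
  \sum_(y | qbit y j == 0) `|T y o| ^+ 2.
Proof.
have -> : delta_mx 0 0 = diag_mx (delta_mx 0 0) :> 'M[C]_2.
  by apply/matrixP => -[[|[|]] //= ?] [[|[|]] //= ?]; rewrite !mxE.
rewrite on_qubit_diag proj0E /unitary_conj mulmx_diag_trace [RHS]big_mkcond.
apply: eq_bigr => y _; rewrite (bigD1 o) //= big1 => [|x /negPf xo].
  by rewrite !mxE !eqxx addr0 mulr1; case: (qbit y j == 0); rewrite ?mul1r ?mul0r.
by rewrite !mxE xo mulr0 mul0r.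
Qed.

Lemma qubit0_probability_le1 (j : 'I_n) (T : 'M[C]_(2 ^ n)) : T \is unitarymx ->
  \tr (on_qubit j (delta_mx 0 0) *m unitary_conj T (proj0 R n)) <= 1.
Proof.
move=> Tu; rewrite qubit0_probability -(unitary_col_norm o Tu).
rewrite [leRHS](bigID (fun y => qbit y j == 0)) /=.
by rewrite lerDl; apply: sumr_ge0 => y _; apply: exprn_ge0.
Qed.

(** The probability is at most 1, and the term at [o], whose qubits are all 0, already reaches 1 for
    [T]. *)
Lemma qubit0_probability_max (j : 'I_n) (T T' : 'M[C]_(2 ^ n)) :
  T \is unitarymx -> T' \is unitarymx -> `|T o o| = 1 ->
  \tr (on_qubit j (delta_mx 0 0) *m unitary_conj T' (proj0 R n)) <=
  \tr (on_qubit j (delta_mx 0 0) *m unitary_conj T (proj0 R n)).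
Proof.
move=> Tu T'u Too; apply: le_trans (qubit0_probability_le1 j T'u) _.
rewrite qubit0_probability (bigD1 o) ?qbit_index0 //= Too expr1n lerDl.
by apply: sumr_ge0 => y _; apply: exprn_ge0.
Qed.

Lemma ler_Re (z w : C) : z <= w -> complex.Re z <= complex.Re w.
Proof. by rewrite lecE => /andP[]. Qed.

Lemma ket0_overlap_max (T T' : 'M[C]_(2 ^ n)) :
  T' \is unitarymx -> `|T o o| = 1 ->
  `|((ket0 R n)^t* *m T' *m ket0 R n) 0 0| ^+ 2 <=
  `|((ket0 R n)^t* *m T *m ket0 R n) 0 0| ^+ 2.
Proof.
move=> T'u Too; rewrite !ket0_overlap Too expr1n expr_le1 ?normr_ge0 //.
exact: unitary_entry_le1 T'u.
Qed.

Lemma C_LET_minimizer (U V : 'M[C]_(2 ^ n)) :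
  U \is unitarymx -> V \is unitarymx ->
  `|(V^t* *m U) o o| = 1 -> minimizers (C_LET U) V.
Proof.
move=> Uu Vu VUo; split=> [|V' V'u]; first exact: Vu.
rewrite /C_LET lerD2l lerN2; apply: ler_Re.
exact: ket0_overlap_max (adjmx_mul_unitary V'u Uu) VUo.
Qed.

Lemma C_LLET_minimizer (U V : 'M[C]_(2 ^ n)) :
  U \is unitarymx -> V \is unitarymx ->
  `|(V^t* *m U) o o| = 1 -> minimizers (C_LLET U) V.
Proof.
move=> Uu Vu VUo; split=> [|V' V'u]; first exact: Vu.
rewrite /C_LLET lerD2l lerN2.
apply: ler_wpM2l; first by rewrite invr_ge0 ler0n.
apply: ler_sum => j _; apply: ler_Re; apply: qubit0_probability_max VUo.
  exact: adjmx_mul_unitary Vu Uu.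
exact: adjmx_mul_unitary V'u Uu.
Qed.

(** * Observables under measurement noise *)

(** All that the costs use of the measurement noise. Positivity of p_00 follows from p_00 > p_01 >=
    0. *)
Lemma measurement_qbit (pm : 'I_n -> 'M[R]_2) (j : 'I_n) (a : 'I_(2 ^ n)) :
  measurement_noise pm ->
  [/\ 0 <= pm j 0 (qbit a j) <= pm j 0 0, 0 < pm j 0 0
    & qbit a j = 1 -> pm j 0 (qbit a j) < pm j 0 0].
Proof.
move=> /(_ j)[p01 _ lt _].
have /andP[q0 _] := p01 0 (qbit a j); have /andP[q1 _] := p01 0 1.
split=> [||->//]; last exact: le_lt_trans lt.
rewrite q0 /=; case: (qbit a j) => -[|[|]] //= i.
  by rewrite le_eqVlt; apply/orP; left; apply/eqP; congr (pm j 0 _); apply/val_inj.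
by apply/ltW; have -> : Ordinal i = 1 by apply/val_inj.
Qed.

Lemma tensor_noisy_P0 (pm : 'I_n -> 'M[R]_2) :
  tensor (fun j => noisy_P0 (pm j)) =
  diag_mx (\row_a (\prod_(j < n) pm j 0 (qbit a j))%:C%C).
Proof.
rewrite (eq_tensor (fun j => noisy_P0E (pm j))) tensor_diag; congr diag_mx.
by apply/rowP => a; rewrite !mxE rmorph_prod; apply: eq_bigr => j _; rewrite mxE.
Qed.

(** A qubit in state 1 makes one factor strictly smaller; the product stays strictly smaller because
    the remaining factors p_00 are positive. *)
Lemma tensor_weight_max (pm : 'I_n -> 'M[R]_2) a :
  measurement_noise pm -> a != o ->
  \prod_(j < n) pm j 0 (qbit a j) < \prod_(j < n) pm j 0 (qbit o j).
Proof.
move=> hpm /qbit_neq0[i ai].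
have h j := measurement_qbit j a hpm.
under [ltRHS]eq_bigr => j _ do rewrite qbit_index0.
have [_ _ /(_ ai) lt] := h i.
rewrite (bigD1 i) // [ltRHS](bigD1 i) //=.
have le : \prod_(j < n | j != i) pm j 0 (qbit a j) <= \prod_(j < n | j != i) pm j 0 0.
  by apply: ler_prod => j _; have [] := h j.
have gt0 : 0 < \prod_(j < n | j != i) pm j 0 0.
  by apply: prodr_gt0 => j _; have [] := h j.
apply: le_lt_trans (_ : pm i 0 (qbit a i) * \prod_(j < n | j != i) pm j 0 0 < _).
  by apply: ler_wpM2l => //; have [/andP[]] := h i.
by rewrite ltr_pM2r.
Qed.

(** By linearity the local measurements amount to one diagonal observable, so that [noisy_optimum]
    covers LLET. *)
Lemma sum_noisy_P0 (pm : 'I_n -> 'M[R]_2) (rho : 'M[C]_(2 ^ n)) :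
  \sum_(j < n) complex.Re (\tr (on_qubit j (noisy_P0 (pm j)) *m rho)) =
  complex.Re (\tr (diag_mx (\row_a (\sum_(j < n) pm j 0 (qbit a j))%:C%C) *m rho)).
Proof.
have -> : diag_mx (\row_a (\sum_(j < n) pm j 0 (qbit a j))%:C%C) =
    \sum_(j < n) on_qubit j (noisy_P0 (pm j)).
  under [RHS]eq_bigr => j _ do rewrite noisy_P0E on_qubit_diag.
  rewrite -linear_sum; congr diag_mx; apply/rowP => a.
  by rewrite !mxE summxE rmorph_sum; apply: eq_bigr => j _; rewrite !mxE.
rewrite mulmx_suml; elim/big_rec2: _ => [|j A x _ ->]; first by rewrite linear0.
by rewrite linearD raddfD.
Qed.

Lemma sum_weight_max (pm : 'I_n -> 'M[R]_2) a :
  measurement_noise pm -> a != o ->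
  \sum_(j < n) pm j 0 (qbit a j) < \sum_(j < n) pm j 0 (qbit o j).
Proof.
move=> hpm /qbit_neq0[i ai].
have h j := measurement_qbit j a hpm.
under [ltRHS]eq_bigr => j _ do rewrite qbit_index0.
have [_ _ /(_ ai) lt] := h i.
rewrite (bigD1 i) // [ltRHS](bigD1 i) //=; apply: ltr_leD => //.
by apply: ler_sum => j _; have [/andP[]] := h j.
Qed.

End Qubits.

(** * Weak resilience of both costs *)

Local Open Scope complex_scope.
Local Open Scope sesquilinear_scope.

Theorem theorem3 (R : realType) (n : nat) (hn : (1 <= n)%N)
    (U : 'M[R[i]]_(2 ^ n)) (hU : U \is unitarymx)
    (P : {linear 'M[R[i]]_(2 ^ n) -> 'M[R[i]]_(2 ^ n)})
    (c : bits n -> bits n -> R) (hP : pauli_noise P c)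
    (l : nat) (p : nat -> R) (hp : forall i : nat, (i <= l)%N -> 0 <= p i <= 1)
    (W : 'M[R[i]]_(2 ^ n) -> nat -> 'M[R[i]]_(2 ^ n))
    (hW : forall V : 'M[R[i]]_(2 ^ n), V \is unitarymx ->
            factorization l (W V) (V^t* *m U))
    (pm : 'I_n -> 'M[R]_2) (hpm : measurement_noise pm)
    (hp_nondegenerate : forall i : nat, (i <= l)%N -> p i != 0)
    (hc_nondegenerate : pauli_nondegenerate c) :
  weak_OPR (C_LET U) (noisy_C_LET pm (fun V => noisy_state P p l (W V))) /\
  weak_OPR (C_LLET U) (noisy_C_LLET pm (fun V => noisy_state P p l (W V))).
Proof.
have p0 i : (i <= l)%N -> 0 < p i.
  by move=> il; rewrite lt_def hp_nondegenerate //; have /andP[] := hp i il.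
have optimum := noisy_optimum hP hc_nondegenerate p0 hW hU.
split=> V [Vu minV].
- apply: (C_LET_minimizer hU Vu).
  apply: (optimum _ (fun a => \prod_(j < n) pm j 0 (qbit a j)) Vu).
    by move=> a; apply: tensor_weight_max hpm.
  move=> V' V'u; have := minV V' V'u.
  by rewrite /noisy_C_LET tensor_noisy_P0 lerD2l lerN2.
- apply: (C_LLET_minimizer hU Vu).
  apply: (optimum _ (fun a => \sum_(j < n) pm j 0 (qbit a j)) Vu).
    by move=> a; apply: sum_weight_max hpm.
  move=> V' V'u; have := minV V' V'u.
  (* Here n >= 1 matters: the factor 1/n is positive and can be cancelled. *)
  rewrite /noisy_C_LLET !sum_noisy_P0 lerD2l lerN2 ler_pM2l //.
  by rewrite invr_gt0 ltr0n.
Qed.
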